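(* Let $l_n$ denote the number of restricted growth functions $f=f_1\cdots f_n$ over $[n]$ such that $u_i=0$ for all $i\in[n]$, where $u_i$ is the number of positions $j<i$ with $j\in\operatorname{LrMax}(f)$, $f_j$ occurring exactly once in $f$, and $f_j<f_i$; set $l_0=l_1=1$. Then for all $n\ge2$, $$l_n=\sum_{k=1}^{n-1}\binom{n-1}{k}\,l_{n-k-1}.$$
   Context: A restricted growth function over $[n]$ is a word $f=f_1\cdots f_n$ with $f_1=1$ and $f_i\le 1+\max\{f_1,\dots,f_{i-1}\}$ for $2\le i\le n$. $\operatorname{LrMax}(f)=\{i: f_i>f_j \text{ for all } j<i\}$. *)

(* Defs.v *)
From mathcomp Require Import all_boot.
Set Implicit Arguments.
Unset Strict Implicit.
Unset Printing Implicit Defensive.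

(* A word f_1 ... f_n over [n]: position i is the ordinal i - 1, and letters
   keep their value in 'I_n.+1, the value 0 being excluded by [is_rgf]. *)
Definition word (n : nat) : predArgType := {ffun 'I_n -> 'I_n.+1}.

Definition is_rgf (n : nat) (f : word n) : bool :=
  [forall i : 'I_n, 0 < f i] &&
  [forall i : 'I_n,
     if i == 0 :> nat then f i == 1 :> nat
     else f i <= 1 + \max_(j < n | j < i) f j].

Definition LrMax (n : nat) (f : word n) : {set 'I_n} :=
  [set i : 'I_n | [forall j : 'I_n, (j < i) ==> (f j < f i)]].

Definition occurs_once (n : nat) (f : word n) (v : 'I_n.+1) : bool :=
  #|[set k : 'I_n | f k == v]| == 1.

Definition u (n : nat) (f : word n) (i : 'I_n) : nat :=
  #|[set j : 'I_n | [&& j < i, j \in LrMax f, occurs_once f (f j) & f j < f i]]|.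

(* The conventions l_0 = l_1 = 1 are values of this count: see [l0], [l1]. *)
Definition l (n : nat) : nat :=
  #|[set f : {ffun 'I_n -> 'I_n.+1} | is_rgf f && [forall i : 'I_n, u f i == 0]]|.

Lemma l0 : l 0 = 1.
Proof.
rewrite /l (_ : [set _ | _] = setT) ?cardsT ?card_ffun ?card_ord //.
apply/setP => f; rewrite !inE /is_rgf.
by apply/andP; split; [apply/andP; split|]; apply/forallP; case.
Qed.

Lemma l1 : l 1 = 1.
Proof.
rewrite /l (_ : [set _ | _] = [set [ffun=> ord_max]]) ?cards1 //.
apply/setP => f; rewrite !inE; apply/idP/eqP => [|->].
  case/andP=> /andP[_ /forallP/(_ ord0)/= /eqP f0] _.
  by apply/ffunP => i; rewrite ffunE (ord1 i); apply: val_inj.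
apply/andP; split; first apply/andP; first split.
- by apply/forallP => i; rewrite ffunE.
- by apply/forallP => i; rewrite (ord1 i) /= ffunE.
apply/forallP => i; rewrite /u cards_eq0; apply/eqP/setP => j.
by rewrite !inE (ord1 i) (ord1 j).
Qed.

(* Main.v *)
Require Import Defs.
From mathcomp Require Import all_boot.
From mathcomp Require Import zify.
Set Implicit Arguments.
Unset Strict Implicit.
Unset Printing Implicit Defensive.

(** A letter of a restricted growth function that occurs only once occurs at a
    left-to-right maximum, and all larger letters appear after it.  So [u] vanishes
    exactly when no letter but the largest one occurs only once.  Deleting the
    letter [1] and lowering the others by one is then a recursion: the [1]s occupy
    position 1 and [k >= 1] of the other [n - 1] positions, and what remains is a
    word of the same kind on the remaining [n - k - 1] positions.

    To avoid relabelling positions, words are counted with an arbitrary support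
    [A] in ['I_n], the letter [0] marking the positions outside [A].  The recursion
    determines the number of these words from [#|A|], so that it is [l #|A|]. *)

(** A witness position replaces the maximum over the prefix, and the letters [0] and [1] are
    unconstrained, so gaps do not disturb the growth condition. *)
Definition rgf_on (n : nat) (f : word n) : bool :=
  [forall i : 'I_n, (1 < f i) ==> [exists j : 'I_n, (j < i) && (f i <= (f j).+1)]].

Definition only_max_single (n : nat) (f : word n) : bool :=
  [forall j : 'I_n, forall i : 'I_n,
     (0 < f j < f i) ==> [exists k : 'I_n, (k != j) && (f k == f j)]].

Definition supp (n : nat) (f : word n) : {set 'I_n} := [set i | 0 < f i].

Definition lset (n : nat) (A : {set 'I_n}) : {set word n} :=
  [set f : word n | rgf_on f && only_max_single f & supp f == A].

Lemma rgf_onP (n : nat) (f : word n) :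
  reflect (forall i, 1 < f i -> exists2 j : 'I_n, j < i & f i <= (f j).+1) (rgf_on f).
Proof.
apply: (iffP forallP) => h i.
  by move=> fi; have /existsP[j /andP[]] := implyP (h i) fi; exists j.
apply/implyP => /h[j ji fij]; apply/existsP; exists j.
by rewrite ji.
Qed.

Lemma only_max_singleP (n : nat) (f : word n) :
  reflect (forall j i, 0 < f j < f i -> exists2 k : 'I_n, k != j & f k = f j)
          (only_max_single f).
Proof.
apply: (iffP forallP) => h j.
  move=> i fij; have /existsP[k /andP[kj /eqP]] := implyP (forallP (h j) i) fij.
  by exists k.
apply/forallP => i; apply/implyP => /h[k kj fkj]; apply/existsP; exists k.
by rewrite kj fkj eqxx.
Qed.

(** Going back from [i] to a witness of growth lowers the letter by at most one, so the descent
    cannot jump over [v]. *)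
Lemma rgf_smaller_before (n : nat) (f : word n) (v : nat) (i : 'I_n) :
  rgf_on f -> 0 < v < f i -> exists2 k : 'I_n, k < i & f k = v :> nat.
Proof.
move=> /rgf_onP h; have [m] := ubnP (i : nat).
elim: m i => // m IHm i im vi.
have [|j ji fij] := h i; first lia.
have [fjv|fjv] := eqVneq (f j : nat) v; first by exists j.
have [||k kj fk] := IHm j; try lia.
by exists k => //; lia.
Qed.

(** * The words counted by [l] as words with full support *)

Lemma is_rgfE (n : nat) (f : word n) : is_rgf f = rgf_on f && (supp f == setT).
Proof.
apply/andP/andP => [[/forallP fpos /forallP h]|[/rgf_onP h /eqP/setP fpos]].
  split; last by apply/eqP/setP => i; rewrite !inE fpos.
  apply/rgf_onP => i fi.
  have [/existsP[j /andP[ji fij]]|/existsPn noj] :=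
    boolP [exists j : 'I_n, (j < i) && (f i <= (f j).+1)]; first by exists j.
  have mx : \max_(j < n | j < i) f j <= f i - 2.
    by apply/bigmax_leqP => j ji; have := noj j; rewrite ji /=; lia.
  by have := h i; case: eqP => [_ /eqP|_]; lia.
have {}fpos i : 0 < f i by have := fpos i; rewrite !inE.
split; apply/forallP => i //; have := fpos i; case: ifP => [/eqP i0|_] fi.
  have [fi1|fi1] := leqP (f i) 1; first by rewrite eqn_leq fi1.
  by have [j] := h i fi1; rewrite i0.
have [fi1|/h[j ji fij]] := leqP (f i) 1; first lia.
have : f j <= \max_(j < n | j < i) f j by apply: (@leq_bigmax_cond _ _ _ j).
by move/(leq_add (leqnn 1)); apply: leq_trans.
Qed.

Lemma u_eq0E (n : nat) (f : word n) :
  is_rgf f -> [forall i, u f i == 0] = only_max_single f.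
Proof.
rewrite is_rgfE => /andP[rf /eqP/setP fpos].
have {}fpos i : 0 < f i by have := fpos i; rewrite !inE.
apply/forallP/only_max_singleP => [h j i /andP[_ fji]|h i].
  have [/existsP[k /andP[kj /eqP fk]]|/existsPn nok] :=
    boolP [exists k : 'I_n, (k != j) && (f k == f j)]; first by exists k.
  have jP k : f k = f j :> nat -> k = j.
    move=> fk; apply/eqP; have := nok k.
    by rewrite (val_inj fk) eqxx andbT negbK.
  have before k : f j < f k -> j < k.
    move=> fjk; have [|k' k'k /jP <- //] := @rgf_smaller_before n f (f j) k rf.
    by rewrite fpos.
  (* If [f j] did not recur, [j] would be one of the positions counted by [u f i]. *)
  suff : j \in set0 by rewrite inE.
  have := h i; rewrite /u cards_eq0 => /eqP <-; rewrite inE before // fji andbT /=.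
  apply/andP; split.
    rewrite inE; apply/forallP => k; apply/implyP => kj.
    have [//|/before|/jP e] := ltngtP (f k) (f j); first lia.
    by rewrite e ltnn in kj.
  apply/cards1P; exists j; apply/setP => k; rewrite !inE.
  by apply/eqP/eqP => [fk|->//]; apply: jP; rewrite fk.
rewrite /u cards_eq0; apply/eqP/setP => j; rewrite !inE; apply/negP.
move=> /and4P[_ _ /cards1P[k fk] fji].
have [|k' k'j fk'] := h j i; first by rewrite fpos.
have : k' \in [set k] by rewrite -fk inE fk'.
have : j \in [set k] by rewrite -fk inE.
by rewrite !inE => /eqP ej /eqP e; rewrite e ej eqxx in k'j.
Qed.

Lemma lE (n : nat) : l n = #|lset [set: 'I_n]|.
Proof.
apply: eq_card => f; rewrite !inE.
have [rf|] := boolP (is_rgf f).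
  by rewrite u_eq0E //; move: rf; rewrite is_rgfE => /andP[-> ->]; rewrite andbT.
by rewrite is_rgfE => /nandP[]/negPf->; rewrite ?andbF.
Qed.

(** * Deleting and restoring the letter 1 *)

Section DeleteOnes.

Variables (n : nat) (A : {set 'I_n}) (a : 'I_n).
Hypotheses (aA : a \in A) (minA : forall i : 'I_n, i \in A -> a <= i).

Definition lower (f : word n) : word n := [ffun i => inord (f i).-1].

Definition raise (g : word n) : word n :=
  [ffun i => if i \in A then inord (g i).+1 else ord0].

(* The [1]s of a word with support [A] can occupy exactly [A :\: C]: they include
   [a], and another position as well if some larger letter occurs. *)
Definition ones_removed (C : {set 'I_n}) : bool :=
  (C \subset A :\ a) && ((C == set0) || (C != A :\ a)).

Definition lowered : {set word n} :=
  [set g : word n | rgf_on g && only_max_single g & ones_removed (supp g)].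

Lemma lowerE (f : word n) (i : 'I_n) : lower f i = (f i).-1 :> nat.
Proof. by rewrite ffunE inordK //; have := ltn_ord (f i); lia. Qed.

(** This bound makes the [inord] in [raise] exact. It starts because a letter 1 of [g] lies strictly
    after [a], hence not at the first position. *)
Lemma lowered_le (g : word n) (i : 'I_n) : g \in lowered -> g i <= i.
Proof.
rewrite !inE => /andP[/andP[/rgf_onP h _] /andP[/subsetP sA _]].
have [m] := ubnP (i : nat); elim: m i => // m IHm i im.
have [gi|/h[j ji gij]] := leqP (g i) 1.
  have [->//|gi0] := posnP (g i).
  have /sA : i \in supp g by rewrite inE.
  by rewrite !inE -val_eqE /= => /andP[ia /minA]; lia.
have := IHm j; lia.
Qed.

Lemma raiseE (g : word n) (i : 'I_n) :
  g \in lowered -> raise g i = (if i \in A then (g i).+1 else 0) :> nat.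
Proof.
move=> /(lowered_le i) gi; rewrite ffunE; case: ifP => // _.
by rewrite inordK //; have := ltn_ord i; lia.
Qed.

Lemma raise_lset (g : word n) : g \in lowered -> raise g \in lset A.
Proof.
move=> gL; have rE i := raiseE i gL; move: (gL).
rewrite !inE => /andP[/andP[/rgf_onP h /only_max_singleP s] /andP[/subsetP sA sC]].
have gA i : 0 < g i -> i \in A /\ i != a.
  move=> gi; have /sA : i \in supp g by rewrite inE.
  by rewrite !inE => /andP[].
have ga : g a = 0 :> nat.
  by apply/eqP; rewrite -leqn0 leqNgt; apply/negP => /gA[_ /eqP].
rewrite -andbA; apply/and3P; split.
- apply/rgf_onP => i; rewrite rE; case: ifP => // iA gi.
  (* A letter 2 of [raise g] is justified by the restored 1 at [a]. *)
  have [gi1|gi1] := leqP (g i) 1.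
    exists a; last by rewrite rE aA ga; lia.
    have [|_] := gA i; first lia.
    by rewrite -val_eqE /=; have := minA iA; lia.
  have [j ji gij] := h i gi1; have [|jA _] := gA j; first lia.
  by exists j => //; rewrite rE jA; lia.
- apply/only_max_singleP => j i; rewrite !rE.
  case: ifP => // jA; case: ifP => [iA gji|]; last lia.
  have [gj|gj] := posnP (g j); last first.
    have [|k kj gk] := s j i; first lia.
    exists k => //; apply: val_inj; rewrite /= !rE jA gk.
    by have [|-> //] := gA k; rewrite gk.
  (* Since [g i] is positive, [supp g] is nonempty, hence a proper subset of [A :\ a]: this leaves
     room for a second 1 besides the one at [a]. *)
  have [k0 k0A gk0] : exists2 k0, k0 \in A :\ a & g k0 = 0 :> nat.
    case/orP: sC => [/eqP/setP/(_ i)|/eqP C]; first by rewrite !inE; lia.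
    case: (boolP (A :\ a \subset supp g)) => [sub|/subsetPn[k kA]].
      by case: C; apply/eqP; rewrite eqEsubset sub andbT; apply/subsetP.
    by rewrite inE -leqNgt leqn0 => /eqP gk; exists k.
  move: k0A; rewrite !inE => /andP[k0a k0A].
  have [ja|ja] := eqVneq a j.
    by exists k0; [rewrite -ja | apply: val_inj; rewrite /= !rE k0A jA gk0 gj].
  by exists a => //; apply: val_inj; rewrite /= !rE aA jA ga gj.
- by apply/eqP/setP => i; rewrite inE rE; case: ifP.
Qed.

Lemma lower_lset (f : word n) : f \in lset A -> lower f \in lowered.
Proof.
rewrite !inE => /andP[/andP[/rgf_onP h /only_max_singleP s] /eqP sA].
have fA i : (i \in A) = (0 < f i) by rewrite -sA inE.
(* A letter above 1 needs an earlier nonzero letter, and [a] is the first position of the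
   support. *)
have fa : f a = 1 :> nat.
  have := aA; rewrite fA => fa; apply/eqP; rewrite eqn_leq fa andbT leqNgt.
  apply/negP => fa1; have [j ja faj] := h a fa1.
  by have := @minA j; rewrite fA; lia.
rewrite -andbA; apply/and3P; split.
- apply/rgf_onP => i; rewrite lowerE => fi.
  have [|j ji fij] := h i; first lia.
  by exists j => //; rewrite lowerE; lia.
- apply/only_max_singleP => j i; rewrite !lowerE => fji.
  have [|k kj fk] := s j i; first lia.
  by exists k => //; apply: val_inj; rewrite /= !lowerE fk.
apply/andP; split.
  apply/subsetP => i; rewrite !inE lowerE fA => fi.
  have [ia|_] := eqVneq i a; last lia.
  by move: fi; rewrite ia fa.
have [->//|/set0Pn[i]] := eqVneq (supp (lower f)) set0.
(* A larger letter occurs at [i], so the 1 at [a] recurs at some [k], which [lower] removes from the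
   support. *)
rewrite inE lowerE => fi; apply/eqP => /setP C.
have [|k ka fk] := s a i; first lia.
by have := C k; rewrite !inE ka lowerE fA fk fa.
Qed.

Lemma card_lset_lowered : #|lset A| = #|lowered|.
Proof.
have lowerK : {in lset A, cancel lower raise}.
  move=> f fL; apply/ffunP => i; apply: val_inj.
  rewrite /= raiseE ?lower_lset // lowerE.
  move: fL; rewrite !inE => /andP[_ /eqP <-]; rewrite inE.
  by case: ifP => [/prednK//|/negbT]; rewrite -leqNgt leqn0 => /eqP.
have raiseK : {in lowered, cancel raise lower}.
  move=> g gL; apply/ffunP => i; apply: val_inj.
  rewrite /= lowerE raiseE //; case: ifP => // iA.
  move: gL; rewrite !inE => /andP[_ /andP[/subsetP/(_ i)]].
  by rewrite !inE iA andbF; case: (nat_of_ord (g i)) => // m /(_ isT).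
have <- : raise @: lowered = lset A.
  apply/setP => f; apply/imsetP/idP => [[g gL ->]|fL]; first exact: raise_lset.
  by exists (lower f); rewrite ?lower_lset ?lowerK.
by rewrite card_in_imset //; apply: can_in_inj raiseK.
Qed.

Lemma card_lset_rec : #|lset A| = \sum_(C : {set 'I_n} | ones_removed C) #|lset C|.
Proof.
rewrite card_lset_lowered -sum1_card (partition_big (@supp n) ones_removed) /=; last first.
  by move=> g; rewrite inE => /andP[].
apply: eq_bigr => C rC; rewrite -sum1_card; apply: eq_bigl => g.
by rewrite !inE; case: eqP => [->|]; rewrite ?rC ?andbT ?andbF.
Qed.

End DeleteOnes.

(** * Counting by the size of the support *)

Lemma sum_subsets_card (T : finType) (D : {set T}) (P : pred nat) (F : nat -> nat) :
  \sum_(C : {set T} | (C \subset D) && P #|C|) F #|C|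
    = \sum_(j < #|D|.+1 | P j) 'C(#|D|, j) * F j.
Proof.
rewrite (partition_big (fun C : {set T} => inord #|C| : 'I_#|D|.+1) P) /=; last first.
  by move=> C /andP[/subset_leq_card CD PC]; rewrite inordK.
apply: eq_bigr => j Pj; rewrite -cards_draws -sum_nat_const.
apply: eq_big => [C|C /andP[/andP[CD _] /eqP <-]]; last first.
  by rewrite inordK // ltnS subset_leq_card.
rewrite inE; have [CD|//] := boolP (C \subset D).
rewrite /= -val_eqE /= inordK ?ltnS ?subset_leq_card //.
by case: eqP => [->|]; rewrite ?Pj ?andbF.
Qed.

Lemma card_lset0 (n : nat) : #|lset (set0 : {set 'I_n})| = 1.
Proof.
rewrite (_ : lset _ = [set [ffun=> ord0]]) ?cards1 //.
apply/setP => f; rewrite !inE; apply/idP/eqP => [/andP[_ /eqP/setP f0]|->].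
  apply/ffunP => i; apply: val_inj; rewrite ffunE /=.
  by have := f0 i; rewrite !inE; case: (nat_of_ord (f i)).
rewrite -andbA; apply/and3P; split.
- by apply/rgf_onP => i; rewrite ffunE.
- by apply/only_max_singleP => j i; rewrite ffunE.
- by apply/eqP/setP => i; rewrite !inE ffunE.
Qed.

Lemma card_lset_step (n : nat) (A : {set 'I_n}) (m : nat) :
  #|A| = m.+1 ->
  (forall C : {set 'I_n}, #|C| <= m -> #|lset C| = l #|C|) ->
  #|lset A| = \sum_(j < m.+1 | (j == 0 :> nat) || (j != m :> nat)) 'C(m, j) * l j.
Proof.
move=> cA IH.
have [a0 a0A] : exists a, a \in A by apply/set0Pn; rewrite -card_gt0 cA.
case: (arg_minnP (P := [in A]) (fun i : 'I_n => i : nat) a0A) => a aA minA.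
have cD : #|A :\ a| = m by move: cA; rewrite (cardsD1 a A) aA => -[].
rewrite (card_lset_rec aA minA).
rewrite -cD -(sum_subsets_card (A :\ a) (fun j => (j == 0) || (j != #|A :\ a|))).
apply: eq_big => [C|C /andP[CD _]]; last by rewrite IH // -cD subset_leq_card.
rewrite /ones_removed cards_eq0; have [CD|//] := boolP (C \subset A :\ a).
(* For a subset of [A :\ a], being proper is a matter of size, so [ones_removed] depends on [#|C|]
   only. *)
by rewrite [C == A :\ a]eqEcard CD /= [in RHS]eqn_leq (subset_leq_card CD).
Qed.

(** [A] and the full set of ['I_#|A|] satisfy the same recursion. The induction on the size ranges
    over all [n], as the two sets live in different types. *)
Lemma card_lset (n : nat) (A : {set 'I_n}) : #|lset A| = l #|A|.
Proof.
have [m] := ubnP #|A|; elim: m n A => // m IHm n A cA.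
case cAE: #|A| => [|p].
  by rewrite (cards0_eq cAE) card_lset0 l0.
rewrite lE (@card_lset_step _ A p) // ?(@card_lset_step _ setT p) // ?cardsT ?card_ord //.
  by move=> C Cp; apply: IHm; lia.
by move=> C Cp; apply: IHm; lia.
Qed.

Theorem theorem19 (n : nat) (hn : 2 <= n) :
  l n = \sum_(1 <= k < n) 'C(n.-1, k) * l (n - k - 1).
Proof.
case: n hn => // m hm; rewrite lE (@card_lset_step _ _ m) ?cardsT ?card_ord //=; last first.
  by move=> C _; apply: card_lset.
rewrite -(big_mkord (fun j => (j == 0) || (j != m)) (fun j => 'C(m, j) * l j)).
(* With [k = m - j] the number of further 1s, the term [k = 0] fails the condition because [m] is
   positive; every [k] from 1 to [m] satisfies it. *)
rewrite big_nat_rev /= big_mkcond big_ltn //= add0n subSS subn0.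
rewrite eqxx orbF (_ : m == 0 = false) ?add0n; last by case: (m) hm.
apply: eq_big_nat => k /andP[k1 km].
rewrite subSS ifT ?bin_sub; try lia.
by congr (_ * l _); lia.
Qed.
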